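(* Let $\mathcal{H}$ be a Hilbert space and consider $\mathcal{X},\mathcal{Y}\subset\mathcal{H}$, where $\mathcal{Y}$ is open and convex. Assume that $q:\mathcal{X}\times\mathcal{Y}\to(0,\infty)$, $(x,y)\mapsto q(y|x)$, has the expression $$q(y|x)=\exp\left(-a(x)-b(y)+c\langle x,y\rangle\right),\qquad\forall(x,y)\in\mathcal{X}\times\mathcal{Y},$$ where $c\ge0$, $a:\mathcal{X}\to\mathbb{R}$, $b:\mathcal{Y}\to\mathbb{R}$, $b$ is $C^1(\mathcal{Y})$, and its derivative $b'$ is locally bounded. Let $P$ be a probability distribution on $\mathcal{X}$ satisfying: for any $y\in\mathcal{Y}$ there is $r=r(y)>0$ such that $$\mathbb{E}_{X\sim P}\left\{(1+\|X\|)^2\exp\left(-a(X)+cr\|X\|+c\langle X,y\rangle\right)\right\}<\infty.$$ Then $\mathbb{E}_{X\sim P}\left((1+\|X\|)\,q(y|X)\right)<\infty$ for all $y\in\mathcal{Y}$ and, with $q_P(y):=\mathbb{E}_{X\sim P}(q(y|X))$, $\mathcal{Y}_P:=\{y\in\mathcal{Y}:q_P(y)>0\}$ and $f_P(y):=\mathbb{E}_{X\sim P}(X\,q(y|X))/q_P(y)$ for $y\in\mathcal{Y}_P$, we have: - $f_P$ is differentiable on $\mathcal{Y}_P=\mathcal{Y}$; - its differential is symmetric positive semi-definite, i.e. $Df_P(y)\succeq0$ for all $y\in\mathcal{Y}$; - $f_P$ implements the proximity operator of a penalty $\varphi_P$. Moreover, if $c>0$ and if the support of the distribution $P$ is not included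 in any hyperplane (i.e. if $P(\langle X,u\rangle=d)<1$ for any nonzero $u\in\mathcal{H}$ and any $d\in\mathbb{R}$), then $\varphi_P$ can be chosen such that: - $Df_P(y)\succ0$ for any $y$; - $f_P$ is injective; - for any $y$, $f_P(y)$ is the unique stationary point (and global minimizer) of $x\mapsto\frac12\|y-x\|^2+\varphi_P(x)$. In particular, $f_P$ is the proximity operator of $\varphi_P$.
   Context: For a proper function $\varphi:\mathcal{H}\to\mathbb{R}\cup\{+\infty\}$ (not identically $+\infty$, possibly nonconvex), called a penalty, $\mathrm{prox}_\varphi(y):=\arg\min_{x\in\mathcal{H}}\{\frac12\|y-x\|^2+\varphi(x)\}$ (a set-valued map). A function $f:S\to\mathcal{H}$, $S\subset\mathcal{H}$, implements the proximity operator of $\varphi$ if $f(y)\in\mathrm{prox}_\varphi(y)$ for every $y\in S$; it is the proximity operator of $\varphi$ (on $S$) if $\mathrm{prox}_\varphi(y)=\{f(y)\}$ for every $y\in S$. A continuous linear operator $L:\mathcal{H}\to\mathcal{H}$ is symmetric if $\langle x,Ly\rangle=\langle Lx,y\rangle$ for all $x,y$; a symmetric continuous linear $L$ is positive semi-definite ($L\succeq0$) if $\langle x,Lx\rangle\ge0$ for all $x$, and positive definite ($L\succ0$) if $\langle x,Lx\rangle>0$ for all nonzero $x$. A point $u\in\mathcal{H}$ is a stationary point of $\varrho:\mathcal{H}\to\mathbb{R}\cup\{+\infty\}$ if $\nabla\varrho(u)=0$ (in which case $\varrho$ is finite on a neighborhood of $u$). If $\mathcal{H}$ is finite dimensional,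 local boundedness of $b'$ is automatic.
   Formalization: That f_P(y) is itself a stationary point is stated only for finite-dimensional H, since it is false in every infinite-dimensional H with Y nonempty (e.g. Gaussian P on l²); uniqueness of stationary points and of the global minimizer is kept for all H. *)

(* Defs.v *)
From HB Require Import structures.
From mathcomp Require Import all_boot all_order all_algebra.
From mathcomp Require Import sesquilinear.
From mathcomp Require Import all_classical all_reals all_analysis.

Set Implicit Arguments.
Unset Strict Implicit.
Unset Printing Implicit Defensive.

Import Order.TTheory GRing.Theory Num.Theory.
Import numFieldNormedType.Exports.

Local Open Scope classical_set_scope.
Local Open Scope ring_scope.

HB.mixin Record CompleteNormedModule_isHilbert (R : realType) H
    & CompleteNormedModule R H := {
  hdot : {dot H for (@idfun R)} ;
  hdotE : forall x : H, hdot x x = `|x| ^+ 2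
}.

#[short(type="hilbertType")]
HB.structure Definition Hilbert (R : realType) :=
  {H of CompleteNormedModule R H & CompleteNormedModule_isHilbert R H}.

Notation "''[' u , v ]" := (hdot u v) : ring_scope.

(* Measurable types are pointed, so the subset [A] comes with an element [a0]:
   no loss of generality when [A] carries a probability. *)
Definition pointed_subset (T : choiceType) (A : set T) (a0 : A) : Type := A.

HB.instance Definition _ (T : choiceType) (A : set T) (a0 : A) :=
  Choice.on (pointed_subset a0).
HB.instance Definition _ (T : choiceType) (A : set T) (a0 : A) :=
  isPointed.Build (pointed_subset a0) a0.

(* Open sets of the subspace topology on [A]; they generate the trace on [A] of
   the Borel sigma-algebra of [T]. The set [A] itself need not be Borel. *)
Definition rel_open (T : topologicalType) (A : set T) (a0 : A) :
    set (set (pointed_subset a0)) :=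
  [set (fun x : pointed_subset a0 => set_val x) @^-1` U | U in @open T].

Arguments rel_open {T A} a0.

Definition borel_subset (T : topologicalType) (A : set T) (a0 : A) :=
  g_sigma_algebraType (rel_open a0).

Section hilbert_valued_expectation.
Context d (T : measurableType d) (R : realType) (H : hilbertType R).
Implicit Types (P : probability T R) (F : T -> H).

(* Weak (Pettis) integral. It agrees with the Bochner integral whenever the
   latter exists, and unlike it does not require [F] to be essentially
   separably valued. *)
Definition is_expectation P F (v : H) :=
  forall u : H, P.-integrable setT (fun t => ('[F t, u])%:E) /\
    'E_P[fun t => '[F t, u]]%E = ('[v, u])%:E.

(* Meaningful only when some [v] satisfies [is_expectation P F v]. *)
Definition expectationH P F : H := get (is_expectation P F).

End hilbert_valued_expectation.

Section posterior_mean.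
Context (R : realType) (H : hilbertType R) (X : set H) (x0 : X).
Variables (P : probability (borel_subset x0) R) (q : X -> H -> R).

Definition marginal (y : H) : R :=
  fine ('E_P[fun x : borel_subset x0 => q x y])%E.

Definition posterior_mean (y : H) : H :=
  (marginal y)^-1 *:
    expectationH P (fun x : borel_subset x0 => q x y *: set_val x).

End posterior_mean.

Section proximity.
Context (R : realType) (H : hilbertType R).
Implicit Types (phi rho : H -> \bar R) (S : set H) (f : H -> H).

Definition penalty phi :=
  (forall x, phi x != -oo%E) /\ exists x, phi x != +oo%E.

Definition prox_obj phi (y x : H) : \bar R :=
  ((2^-1 * `|y - x| ^+ 2)%:E + phi x)%E.

Definition prox phi (y : H) : set H :=
  [set x | forall z, (prox_obj phi y x <= prox_obj phi y z)%E].

Definition implements_prox S f phi := forall y, S y -> prox phi y (f y).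

Definition is_prox S f phi := forall y, S y -> prox phi y = [set f y].

(* Without finiteness near [u], the truncation [fine] of infinite values to 0
   would make the differential meaningless. *)
Definition stationary rho (u : H) :=
  (\forall x \near u, rho x \is a fin_num) /\
  is_diff u (fine \o rho : H -> R) (fun=> 0).

End proximity.

Section operators.
Context (R : realType) (H : hilbertType R).
Implicit Types L : {linear H -> H}.

Definition symmetric_op L :=
  continuous L /\ forall x y : H, '[x, L y] = '[L x, y].

Definition psd_op L := symmetric_op L /\ forall x : H, 0 <= '[x, L x].

Definition pd_op L :=
  symmetric_op L /\ forall x : H, x != 0 -> 0 < '[x, L x].

End operators.

Section C1.
Context (R : realType) (V : normedModType R).
Implicit Types (U : set V) (b : V -> R).

(* On an open [U]; the derivative is continuous in operator norm. *)
Definition C1_on U b :=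
  (forall y, U y -> differentiable b y) /\
  forall y, U y -> forall e : R, 0 < e ->
    \forall z \near y, forall h : V,
      `|'d b z h - 'd b y h| <= e * `|h|.

Definition diff_locally_bounded U b :=
  forall y, U y -> exists M : R,
    \forall z \near y, forall h : V, `|'d b z h| <= M * `|h|.

(* For c > 0, in infinite dimension, a posterior mean is never stationary for its
   proximal objective (the objective is infinite arbitrarily close to it or is
   not differentiable there), although it may be its unique minimizer. *)
Definition finite_dimensional :=
  exists n (e : 'I_n -> V), forall x : V,
    exists k : 'I_n -> R, x = \sum_(i < n) k i *: e i.

End C1.

Arguments finite_dimensional {R} V.

(* Main.v *)
From HB Require Import structures.
Require Import Defs.
From mathcomp Require Import all_boot all_order all_algebra.
From mathcomp Require Import sesquilinear ring lra.
From mathcomp Require Import all_classical all_reals all_analysis.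
From mathcomp Require Import measurable_realfun.

(* With Z(y) = E[exp(-a(X) + c<X,y>)], the factor exp(-b) cancels in f_P, which
   is the gradient of psi = (ln Z) / c. The inequality e^s >= 1 + s, applied to
   s = c<X - f_P(y), z - y> and integrated against the density q(y|.) / q_P(y),
   gives psi(z) >= psi(y) + <f_P(y), z - y> (strictly in the nondegenerate case),
   and its quadratic remainder gives Df_P(y) = c Cov_y(X). The penalty is
   psi^* - |.|^2 / 2: its proximal objective at y is |y|^2 / 2 - <., y> + psi^*,
   minimal exactly at the subgradients of psi at y, that is, at f_P(y). *)

Set Implicit Arguments.
Unset Strict Implicit.
Unset Printing Implicit Defensive.

Import Order.TTheory GRing.Theory Num.Theory.
Import numFieldNormedType.Exports.

Local Open Scope classical_set_scope.
Local Open Scope ring_scope.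

(** * Hilbert spaces *)

(** Means and covariances are known only through their scalar products with fixed vectors: the Riesz
    theorem produces them, and [norm_le_hdot] turns scalar estimates into norm bounds. At a base
    point y the law is normalized to mass one and X is centered at f_P(y), so the zeroth and first
    order terms of the tilted integrals are explicit and only e^s - 1 - s has to be estimated. The
    obstacle there is a missing moment: this remainder times |X| is of order three in |X|, while two
    powers are assumed; restricting to |z - y| <= r / 2 leaves half of the exponential to pay for
    the third. The case c = 0, where ln Z / c is meaningless, is treated apart. That f_P(y) is
    itself stationary asks for differentiability of psi^* at f_P(y). This comes from strong
    monotonicity of f_P near y, hence from a uniform lower bound on Df_P(y), which positive
    definiteness gives in finite dimension. *)

Section hilbert.
Context (R : realType) (H : hilbertType R).
Implicit Types (u v w x y : H) (k : R).

Lemma hdotC u v : '[u, v] = '[v, u].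
Proof. by rewrite (hermC hdot) expr0 mul1r. Qed.

Lemma hdotDl u v w : '[u + v, w] = '[u, w] + '[v, w].
Proof. exact: linearDl. Qed.

Lemma hdotDr u v w : '[u, v + w] = '[u, v] + '[u, w].
Proof. exact: linearDr. Qed.

Lemma hdotNl u v : '[- u, v] = - '[u, v].
Proof. exact: linearNl. Qed.

Lemma hdotNr u v : '[u, - v] = - '[u, v].
Proof. exact: linearNr. Qed.

Lemma hdotBl u v w : '[u - v, w] = '[u, w] - '[v, w].
Proof. exact: linearBl. Qed.

Lemma hdotBr u v w : '[u, v - w] = '[u, v] - '[u, w].
Proof. exact: linearBr. Qed.

Lemma hdotZr k u v : '[u, k *: v] = k * '[u, v].
Proof. exact: linearZr_LR. Qed.

Lemma hdotZl k u v : '[k *: u, v] = k * '[u, v].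
Proof. by rewrite hdotC hdotZr hdotC. Qed.

Lemma hdot0l u : '[0, u] = 0.
Proof. exact: linear0l. Qed.

Lemma hdot0r u : '[u, 0] = 0.
Proof. exact: linear0r. Qed.

Definition hdot_linE := (hdotDl, hdotDr, hdotBl, hdotBr, hdotNl, hdotNr, hdotZl, hdotZr).

Lemma hdotP u v : (forall w, '[u, w] = '[v, w]) -> u = v.
Proof.
move=> uv; apply/eqP; rewrite -subr_eq0 -normr_eq0 -sqrf_eq0 -hdotE.
by rewrite hdotBl uv subrr.
Qed.

Lemma hdot_norm u v : `|'[u, v]| <= `|u| * `|v|.
Proof.
have [->|v0] := eqVneq v 0; first by rewrite hdot0r !normr0 mulr0.
rewrite -ler_sqr ?nnegrE ?mulr_ge0// real_normK ?num_real// exprMn.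
(* This vector is |v|^2 times the component of [u] orthogonal to [v]; its squared norm is |v|^2
   (|u|^2 |v|^2 - <u,v>^2). *)
have := sqr_ge0 `| `|v| ^+ 2 *: u - '[u, v] *: v|.
rewrite -hdotE !hdot_linE (hdotC v u) !hdotE.
have : 0 < `|v| ^+ 2 by rewrite exprn_gt0// normr_gt0.
move: (`|v| ^+ 2) (`|u| ^+ 2) ('[u, v]) => V U D V0.
set E := (X in 0 <= X).
have -> : E = V * (U * V - D ^+ 2) by rewrite /E; ring.
by rewrite pmulr_rge0// subr_ge0.
Qed.

Lemma hdot_ler u v : '[u, v] <= `|u| * `|v|.
Proof. exact: le_trans (ler_norm _) (hdot_norm u v). Qed.

Lemma norm_le_hdot u M : 0 <= M -> (forall w, '[u, w] <= M * `|w|) -> `|u| <= M.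
Proof.
move=> M0 /(_ u); rewrite hdotE expr2.
have [->|u0] := eqVneq u 0; first by rewrite normr0.
by rewrite ler_pM2r// normr_gt0.
Qed.

Section riesz.
Variables (l : H -> R) (M : R).
Hypothesis lP : forall k u v, l (k *: u + v) = k * l u + l v.
Hypothesis lM : forall u, `|l u| <= M * `|u|.

(* The witness is a near-minimizer of [|u|^2 - 2 l u]. *)
Lemma riesz_approx e : 0 < e ->
  exists u, forall w, `|'[u, w] - l w| <= e * `|w|.
Proof.
move=> e0; pose J u := `|u| ^+ 2 - 2 * l u.
have Jbd u : - M ^+ 2 <= J u.
  rewrite /J; have := le_trans (ler_norm _) (lM u).
  by have := sqr_ge0 (`|u| - M); nra.
have Jinf : has_inf (range J).
  split; first by exists (J 0), 0.
  by exists (- M ^+ 2) => _ [u _ <-].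
have [_ [u _ <-] uJ] := inf_adherent (exprn_gt0 2 e0) Jinf.
exists u => w.
have Jt t : J u - e ^+ 2 <= J (t *: w + u).
  apply: (@le_trans _ _ (inf (range J))); first by rewrite lerBlDr ltW.
  by apply: ge_inf; [exact: Jinf.2|exists (t *: w + u)].
have {}Jt t : 0 <= t ^+ 2 * `|w| ^+ 2 + 2 * t * ('[u, w] - l w) + e ^+ 2.
  have := Jt t; rewrite /J lP -!hdotE !hdot_linE (hdotC w u).
  by move: ('[u, u]) ('[u, w]) ('[w, w]) => a b c; nra.
have [->|w0] := eqVneq w 0.
  by have := lM 0; rewrite hdot0r !normr0 sub0r normrN !mulr0.
rewrite -ler_sqr ?nnegrE ?mulr_ge0 ?(ltW e0)// real_normK ?num_real// exprMn.
(* The minimizer in [t] of the quadratic polynomial of [Jt]; nonnegativity there is the discriminant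
   inequality. *)
have := Jt (- ('[u, w] - l w) / `|w| ^+ 2).
have : 0 < `|w| ^+ 2 by rewrite exprn_gt0// normr_gt0.
move: (`|w| ^+ 2) ('[u, w] - l w) (e ^+ 2) => W D E W0.
have -> : (- D / W) ^+ 2 * W + 2 * (- D / W) * D + E = (E * W - D ^+ 2) / W.
  by field; rewrite gt_eqF.
by rewrite pmulr_lge0 ?invr_gt0// subr_ge0.
Qed.

(** Approximate representers with errors 1/(n+1) lie within the sum of their errors of each other,
    so they form a Cauchy sequence; completeness supplies the limit. *)
Lemma riesz : exists v, forall w, l w = '[v, w].
Proof.
have [u uP] := choice (fun n => riesz_approx (harmonic_gt0 n : 0 < _)).
have uB n m : `|u n - u m| <= n.+1%:R^-1 + m.+1%:R^-1.
  apply: norm_le_hdot => [|w]; first by rewrite addr_ge0.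
  apply: le_trans (ler_norm _) _.
  have -> : '[u n - u m, w] = ('[u n, w] - l w) - ('[u m, w] - l w).
    by rewrite hdotBl; ring.
  by apply: le_trans (ler_normB _ _) _; rewrite mulrDl lerD ?uP.
have near_harm e : 0 < e -> \forall n \near \oo, n.+1%:R^-1 < e :> R.
  by move=> e0; have := near_infty_natSinv_lt (PosNum e0).
have ucvg : cvgn u.
  apply: cauchy_cvg; apply: cauchy_exP => e e0.
  have e20 : 0 < e / 2 by rewrite divr_gt0.
  have [N _ NP] := near_harm _ e20; exists (u N).
  exists N => // n /= Nn; rewrite -ball_normE /=.
  apply: le_lt_trans (uB _ _) _; rewrite (splitr e) ltrD//; apply: NP => //=.
exists (limn u) => w; apply/eqP; rewrite -subr_eq0 -normr_le0.
apply/ler_addgt0Pl => e e0; rewrite addr0.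
(* The added 1 keeps the denominator positive when [w] is zero. *)
pose d := e / (2 * (`|w| + 1)).
have d0 : 0 < d by rewrite divr_gt0// mulr_gt0// ltr_wpDl.
near \oo => n.
have -> : l w - '[limn u, w] = ('[u n, w] - '[limn u, w]) - ('[u n, w] - l w) by ring.
apply: le_trans (ler_normB _ _) _.
have h1 : `|'[u n, w] - l w| <= d * `|w|.
  apply: le_trans (uP n w) _; rewrite ler_wpM2r// ltW//.
  by near: n; apply: near_harm.
have h2 : `|'[u n, w] - '[limn u, w]| <= d * `|w|.
  rewrite -hdotBl; apply: le_trans (hdot_norm _ _) _; rewrite ler_wpM2r//.
  rewrite distrC ltW//; near: n.
  by have /cvgrPdist_lt /(_ _ d0) := ucvg.
apply: le_trans (lerD h2 h1) _.
rewrite -mulr2n -mulr_natl mulrA mulrC /d.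
have w1 : 0 < `|w| + 1 by rewrite ltr_wpDl.
have -> : `|w| * (2 * (e / (2 * (`|w| + 1)))) = e * (`|w| / (`|w| + 1)).
  by field; rewrite gt_eqF.
by rewrite ger_pMr// ler_pdivrMr// mul1r lerDl.
Unshelve. all: by end_near. Qed.

End riesz.

Lemma is_diff_quadratic (V W : normedModType R) (f : V -> W) (y : V)
    (L : {linear V -> W}) (C : R) :
  continuous L ->
  (\forall h \near (0 : V), `|f (y + h) - f y - L h| <= C * `|h| ^+ 2) ->
  is_diff y f L.
Proof.
move=> Lc fL.
have fE : f \o shift y = cst (f y) + L +o_ (0 : V) id.
  apply/eqaddoP => e e0; near=> h.
  rewrite [X in `|X|](_ : _ = f (y + h) - f y - L h); last first.
    by rewrite !fctE /= opprD addrA (addrC h).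
  (* [C] has no prescribed sign, so a positive upper bound replaces it before dividing. *)
  have [M0 MP] : 0 < `|C| + 1 /\ C <= `|C| + 1.
    by split; [rewrite ltr_wpDl|rewrite ler_wpDr// ler_norm].
  apply: (@le_trans _ _ (C * `|h| ^+ 2)); first by near: h.
  rewrite expr2 mulrA ler_wpM2r//.
  apply: (@le_trans _ _ ((`|C| + 1) * `|h|)); first by rewrite ler_wpM2r.
  rewrite mulrC -ler_pdivlMr// ltW//.
  by near: h; apply: nbhs0_lt; rewrite divr_gt0.
have dE := diff_unique Lc fE.
apply: DiffDef => //; apply/diff_locallyP; rewrite dE; split => //.
Unshelve. all: by end_near. Qed.

End hilbert.

(** * Penalties from subgradients *)

Section subgradient.
Context (R : realType) (H : hilbertType R).
Variables (Y : set H) (f : H -> H) (psi : H -> R).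
Hypothesis Yopen : open Y.
Hypothesis psiP : forall y z, Y y -> Y z -> psi y + '[f y, z - y] <= psi z.

(** The supremum is restricted to [Y] because [psi] is controlled only there: this is the Fenchel
    conjugate of [psi] extended by +oo outside [Y]. *)
Definition conjugate (x : H) : \bar R :=
  ereal_sup [set ('[x, z] - psi z)%:E | z in Y].

Definition conjugate_penalty (x : H) : \bar R :=
  (conjugate x - (2^-1 * `|x| ^+ 2)%:E)%E.

Local Notation phi := conjugate_penalty.
Local Notation obj := (prox_obj phi).

Lemma prox_objE y x :
  obj y x = (conjugate x + (2^-1 * `|y| ^+ 2 - '[x, y])%:E)%E.
Proof.
rewrite /prox_obj addeCA -EFinN -EFinD; congr (_ + _%:E)%E.
by rewrite -!hdotE !hdot_linE (hdotC y x); field.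
Qed.

Lemma prox_obj_leP y x k : (obj y x <= k%:E)%E <->
  forall z, Y z -> 2^-1 * `|y| ^+ 2 + '[x, z - y] - psi z <= k.
Proof.
rewrite prox_objE -leeBrDr// -EFinB; split => [/ereal_supP conjk z Yz|xk].
  have := conjk _ (ex_intro2 _ _ z Yz erefl).
  by rewrite lee_fin hdotBr; lra.
apply/ereal_supP => _ [z Yz <-]; rewrite lee_fin.
by have := xk z Yz; rewrite hdotBr; lra.
Qed.

Lemma prox_obj_ge y x z : Y z ->
  ((2^-1 * `|y| ^+ 2 + '[x, z - y] - psi z)%:E <= obj y x)%E.
Proof.
move=> Yz; rewrite prox_objE -leeBlDr// -EFinB.
apply: ereal_sup_ubound; exists z => //; congr _%:E.
by rewrite hdotBr; ring.
Qed.

(** The equality case of the Fenchel-Young inequality, at a subgradient. *)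
Lemma prox_obj_grad y : Y y -> obj y (f y) = (2^-1 * `|y| ^+ 2 - psi y)%:E.
Proof.
move=> Yy; apply/eqP; rewrite eq_le; apply/andP; split.
  by apply/prox_obj_leP => z Yz; have := psiP Yy Yz; lra.
by have := prox_obj_ge y (f y) Yy; rewrite subrr hdot0r addr0.
Qed.

Lemma implements_prox_conjugate : implements_prox Y f phi.
Proof.
move=> y Yy z; rewrite prox_obj_grad//.
by have := prox_obj_ge y z Yy; rewrite subrr hdot0r addr0.
Qed.

Lemma penalty_conjugate : Y !=set0 -> penalty phi.
Proof.
move=> [y Yy]; split=> [x|].
  apply/negP => /eqP phix; have := prox_obj_ge y x Yy.
  by rewrite /prox_obj phix.
exists (f y); apply/negP => /eqP phix; have := prox_obj_grad Yy.
by rewrite /prox_obj phix.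
Qed.

(** Uniqueness comes from continuity of [f] at [y]. A minimizer [x] is a subgradient of [psi] at
    [y]; comparing it with the subgradient at y + t h, where h = x - f y, gives |h|^2 <= <f (y + t
    h) - f y, h>, which fails for small t unless h = 0. *)
Lemma prox_conjugate_unique y x : Y y -> {for y, continuous f} ->
  (obj y x <= obj y (f y))%E -> x = f y.
Proof.
move=> Yy fc; rewrite prox_obj_grad// => /prox_obj_leP xP.
apply: contrapT => /eqP; rewrite -subr_eq0.
set h := x - f y => h0.
have hgt0 : 0 < `|h| by rewrite normr_gt0.
have /cvgrPdist_lt /(_ _ hgt0) fnear := fc.
have : \forall z \near y, Y z /\ `|f y - f z| < `|h|.
  by apply: filterI => //; apply: open_nbhs_nbhs.
move=> /nbhs_ballP [d /= d0 dP].
pose t := d / 2 / `|h|.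
have t0 : 0 < t by rewrite !divr_gt0.
have [|Yz fz] := dP (y + t *: h).
  rewrite -ball_normE /= opprD addrA subrr sub0r normrN normrZ gtr0_norm//.
  by rewrite /t divfK ?gt_eqF// ltr_pdivrMr// ltr_pMr// ltr1n.
have := xP _ Yz; have := psiP Yz Yy.
have -> : y + t *: h - y = t *: h by rewrite addrC addKr.
rewrite opprD addrA subrr sub0r hdotNr !hdotZr.
move=> h1 h2; have : 0 <= t * '[f (y + t *: h) - x, h] by rewrite hdotBl; lra.
rewrite pmulr_rge0//.
have -> : f (y + t *: h) - x = (f (y + t *: h) - f y) - h.
  by rewrite /h opprB addrA subrK.
rewrite hdotBl hdotE subr_ge0 leNgt => /negP; apply.
apply: le_lt_trans (hdot_ler _ _) _.
by rewrite expr2 ltr_pM2r// distrC.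
Qed.

Lemma is_prox_conjugate : (forall y, Y y -> {for y, continuous f}) ->
  is_prox Y f phi.
Proof.
move=> fc y Yy; apply/seteqP; split=> [x xP|_ ->] /=.
  by apply: prox_conjugate_unique => //; exact: fc.
exact: implements_prox_conjugate.
Qed.

(** The quadratic terms cancel, so the objective is a supremum of affine functions of the point,
    hence convex even where [phi] is not. *)
Lemma prox_obj_convex y u x a b t : obj y u = a%:E -> obj y x = b%:E ->
  0 <= t <= 1 -> (obj y (t *: (x - u) + u)%R <= (a + t * (b - a))%:E)%E.
Proof.
move=> ua xb /andP[t0 t1]; apply/prox_obj_leP => z Yz.
have := prox_obj_ge y u Yz; have := prox_obj_ge y x Yz.
rewrite ua xb !lee_fin hdotDl hdotZl hdotBl.
move: ('[x, z - y]) ('[u, z - y]) => X U h1 h2; nra.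
Qed.

End subgradient.

(** * Stationary points of the proximal objective *)

Lemma is_diff_littleo (R : realType) (V : normedModType R) (F : V -> R) u :
  is_diff u F (fun=> 0) -> forall e, 0 < e ->
  \forall h \near (0 : V), `|F (h + u) - F u| <= e * `|h|.
Proof.
move=> [dF FE] e e0.
have /diff_locallyP [_ /eqaddoP /(_ _ e0)] := dF.
rewrite FE; apply: filterS => h /=.
by rewrite !fctE /= addr0.
Qed.

Section stationarity.
Context (R : realType) (H : hilbertType R).
Variables (Y : set H) (f : H -> H) (psi : H -> R).
Hypothesis Yopen : open Y.
Hypothesis psiP : forall y z, Y y -> Y z -> psi y + '[f y, z - y] <= psi z.
Local Notation phi := (conjugate_penalty Y psi).
Local Notation obj := (prox_obj phi).

(* A stationary point of a convex function is a global minimizer. *)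
Lemma stationary_conjugate y u : Y y -> {for y, continuous f} ->
  stationary (obj y) u -> u = f y.
Proof.
move=> Yy fc [ufin /is_diff_littleo uo].
apply: (prox_conjugate_unique Yopen psiP) => //.
have xb := prox_obj_grad psiP Yy.
have ua := esym (fineK (nbhs_singleton ufin)).
rewrite xb ua lee_fin leNgt; apply/negP.
set b := (X in X < _); set a := (X in _ < X) => ba.
pose k := f y - u.
have k0 : 0 < `|k|.
  rewrite normr_gt0 subr_eq0; apply/negP => /eqP fyu.
  by move: ba; rewrite /a -fyu xb ltxx.
(* Half the mean slope from [u] to [f y]: convexity forces a decrease at the full slope, which this
   tolerance forbids. *)
have e0 : 0 < (a - b) / (2 * `|k|) by rewrite divr_gt0 ?subr_gt0// mulr_gt0.
have : \forall h \near (0 : H), obj y (h + u) \is a fin_num /\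
    `|fine (obj y (h + u)) - a| <= (a - b) / (2 * `|k|) * `|h|.
  apply: filterI; last exact: uo.
  by move: ufin; rewrite (near_shift 0) subr0; apply: filterS => h /=; rewrite addrC.
move=> /nbhs_ballP [d /= d0 dP].
(* The bound 1 stays on the segment, where convexity applies; the other bound stays in the ball of
   radius [d]. *)
pose t := Num.min 1 (d / 2 / `|k|).
have t0 : 0 < t by rewrite lt_min ltr01 !divr_gt0.
have [|gfin gle] := dP (t *: k).
  rewrite -ball_normE /= sub0r normrN normrZ gtr0_norm//.
  apply: (@le_lt_trans _ _ (d / 2 / `|k| * `|k|)).
    by rewrite ler_wpM2r// ge_min lexx orbT.
  by rewrite divfK ?gt_eqF// ltr_pdivrMr// ltr_pMr// ltr1n.
have t01 : 0 <= t <= 1 by rewrite (ltW t0) ge_min lexx.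
have := prox_obj_convex ua xb t01; rewrite -/k -(fineK gfin) lee_fin -/a -/b.
move: gle; rewrite normrZ gtr0_norm// ler_norml => /andP[+ _] h2.
have -> : (a - b) / (2 * `|k|) * (t * `|k|) = t * (a - b) / 2.
  by field; rewrite gt_eqF.
have : 0 < t * (a - b) by rewrite mulr_gt0// subr_gt0.
by move: h2; lra.
Qed.

(** By duality, quadratic growth of [psi] above its tangent at [y] bounds the objective above by a
    quadratic at [f y]. Since [f y] is also a minimizer, the objective is squeezed between a
    constant and that quadratic, so its differential there is zero. *)
Lemma stationary_grad y m d : Y y -> 0 < m -> 0 < d ->
  (forall k, `|k| <= d -> Y (y + k) /\ m * `|k| ^+ 2 <= '[f (y + k) - f y, k]) ->
  stationary (obj y) (f y).
Proof.
move=> Yy m0 d0 fP.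
(* Strong monotonicity near [y] propagates to linear growth far from [y]. *)
have grow t h : 0 < t -> t < 1 -> `|t *: h| <= d -> Y (y + h) ->
    (1 - t) * (m * t * `|h| ^+ 2) <= psi (y + h) - psi y - '[f y, h].
  move=> t0 t1 td Yh; have [Yt] := fP _ td.
  have := psiP Yy Yt; have := psiP Yt Yh.
  have -> : y + t *: h - y = t *: h by rewrite addrC addKr.
  rewrite opprD addrACA subrr add0r.
  rewrite -[X in X - t *: _]scale1r -scalerBl !hdotZr normrZ gtr0_norm// hdotBl.
  rewrite exprMn => h1 h2 h3.
  have {}h3 : m * t * `|h| ^+ 2 <= '[f (y + t *: h), h] - '[f y, h].
    by rewrite -(ler_pM2l t0); move: h3; rewrite expr2; lra.
  have : (1 - t) * (m * t * `|h| ^+ 2) <=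
      (1 - t) * ('[f (y + t *: h), h] - '[f y, h]).
    by rewrite ler_wpM2l// subr_ge0 ltW.
  by move: h1 h2; lra.
have half0 : 0 < 2^-1 :> R by rewrite invr_gt0.
have half1 : 2^-1 < 1 :> R by rewrite invf_lt1 ?ltr1n.
have upper w : `|w| <= m * d / 2 ->
    (obj y (f y + w)%R <= (2^-1 * `|y| ^+ 2 - psi y + m^-1 * `|w| ^+ 2)%:E)%E.
  move=> wd; apply/prox_obj_leP => z Yz.
  pose h := z - y; have zE : z = y + h by rewrite addrC subrK.
  rewrite -/h; rewrite zE in Yz *.
  have wh := hdot_ler w h.
  suff : `|w| * `|h| - (psi (y + h) - psi y - '[f y, h]) <= m^-1 * `|w| ^+ 2.
    by rewrite hdotDl; lra.
  (* For |h| <= 2 d, t = 1/2 gives growth m |h|^2 / 4 and completing the square concludes. Farther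
     away, t = d / |h| gives growth at least m d |h| / 2, which absorbs |w| |h| since |w| <= m d /
     2. *)
  have [hd|hd] := leP `|h| (2 * d).
    have := grow 2^-1 h half0 half1; rewrite normrZ gtr0_norm// ler_pdivrMl//.
    move=> /(_ hd Yz).
    have : 0 <= m^-1 * (`|w| - m / 2 * `|h|) ^+ 2.
      by rewrite mulr_ge0 ?sqr_ge0// invr_ge0 ltW.
    have -> : m^-1 * (`|w| - m / 2 * `|h|) ^+ 2 =
      m^-1 * `|w| ^+ 2 - `|w| * `|h| + m / 4 * `|h| ^+ 2.
      by field; rewrite gt_eqF.
    by lra.
  have h0 : 0 < `|h| by apply: le_lt_trans hd; rewrite mulr_ge0 ?ltW.
  have t0 : 0 < d / `|h| by rewrite divr_gt0.
  have t2 : d / `|h| < 2^-1 by rewrite ltr_pdivrMr// ltr_pdivlMl//.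
  have := grow _ h t0 (lt_trans t2 half1); rewrite normrZ gtr0_norm//.
  rewrite divfK ?gt_eqF// => /(_ (lexx _) Yz).
  have -> : m * (d / `|h|) * `|h| ^+ 2 = m * d * `|h|.
    by field; rewrite gt_eqF.
  have : 0 <= m^-1 * `|w| ^+ 2 by rewrite mulr_ge0 ?sqr_ge0// invr_ge0 ltW.
  have : `|w| * `|h| <= m * d / 2 * `|h| by rewrite ler_wpM2r.
  have : 2^-1 * (m * d * `|h|) <= (1 - d / `|h|) * (m * d * `|h|).
    by rewrite ler_wpM2r ?mulr_ge0 ?(ltW m0) ?(ltW d0)//; lra.
  by lra.
have lower x : ((2^-1 * `|y| ^+ 2 - psi y)%:E <= obj y x)%E.
  by have := prox_obj_ge psi y x Yy; rewrite subrr hdot0r addr0.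
have md0 : 0 < m * d / 2 by rewrite divr_gt0// mulr_gt0.
have fin w : `|w| <= m * d / 2 -> obj y (f y + w) \is a fin_num.
  move=> wd; apply: fin_real; rewrite (lt_le_trans _ (lower _)) ?ltNyr//=.
  by rewrite (le_lt_trans (upper _ wd)) ?ltry.
have near0 : \forall w \near (0 : H), `|w| <= m * d / 2.
  by apply: filterS (nbhs0_lt md0) => w /ltW.
split.
  rewrite (near_shift 0) subr0; apply: filterS near0 => w /= /fin.
  by rewrite addrC.
apply: (@is_diff_quadratic _ _ _ _ _ (\0 : {linear H -> R}) m^-1) => /=.
  exact: cst_continuous.
apply: filterS near0 => w wd.
have := lower (f y + w); have := upper _ wd.
rewrite -(fineK (fin _ wd)) !lee_fin prox_obj_grad//= subr0 => h1 h2.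
by rewrite ler_norml; lra.
Qed.

End stationarity.

(** * Coercivity of positive definite operators in finite dimension *)

Section coercivity.
Context (R : realType) (H : hilbertType R) (L : {linear H -> H}).
Hypothesis Lpd : pd_op L.

(* The last clause ([L]-orthogonal projection onto [W]) makes the property stable
   under adjoining a vector. *)
Definition coercive_subspace (W : set H) :=
  [/\ W 0, (forall k u v, W u -> W v -> W (k *: u + v)),
      (exists2 m : R, 0 < m & forall h, W h -> m * `|h| ^+ 2 <= '[h, L h]) &
      forall e, exists2 v, W v & forall w, W w -> '[e - v, L w] = 0].

(** A Gram-Schmidt step for the form <., L .>: the part [g] of [e] that is [L]-orthogonal to [W]
    creates no cross terms, so the form on the enlarged space is the sum of its values on [W] and on
    the line of [g]. *)
Lemma coercive_subspace_add W e : coercive_subspace W ->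
  exists2 W', coercive_subspace W' & W' e /\ W `<=` W'.
Proof.
move=> Wco; have [W0 Wlin [m m0 mP] Wproj] := Wco.
have [[Lc Lsym] Lpos] := Lpd.
have [v Wv vP] := Wproj e.
have [g gE] : exists g, g = e - v by exists (e - v).
rewrite -gE in vP.
(* Here [e] already lies in [W]; this case allows generating families that are linearly
   dependent. *)
have [g0|g0] := eqVneq g 0.
  by exists W => //; split => //; rewrite -[e](subrK v) -gE g0 add0r.
pose d := '[g, L g]; have d0 : 0 < d by exact: Lpos.
have gn0 : 0 < `|g| ^+ 2 by rewrite exprn_gt0// normr_gt0.
have gLw w : W w -> '[g, L w] = 0 by exact: vP.
have wLg w : W w -> '[w, L g] = 0 by move=> Ww; rewrite Lsym hdotC gLw.
have LE w t : L (w + t *: g) = L w + t *: L g by rewrite linearD linearZ.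
exists [set w + t *: g | w in W & t in setT]; last first.
  split; first by exists v => //; exists 1 => //; rewrite scale1r gE addrC subrK.
  by move=> w Ww; exists w => //; exists 0 => //; rewrite scale0r addr0.
split.
- by exists 0 => //; exists 0 => //; rewrite scale0r addr0.
- move=> k _ _ [w1 Ww1 [t1 _ <-]] [w2 Ww2 [t2 _ <-]].
  exists (k *: w1 + w2); first exact: Wlin.
  by exists (k * t1 + t2) => //; rewrite scalerDr scalerDl scalerA addrACA.
- pose n := Num.min m (d / `|g| ^+ 2).
  have n0 : 0 < n by rewrite lt_min m0 divr_gt0.
  (* The factor 2 is lost in |w + t g|^2 <= 2 |w|^2 + 2 t^2 |g|^2, as [w] and [g] are orthogonal for
     the form of [L] only. *)
  exists (n / 2); first by rewrite divr_gt0.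
  move=> _ [w Ww [t _ <-]].
  rewrite LE !hdot_linE gLw// wLg// -/d !mulr0 addr0 add0r.
  have h1 : n * `|w| ^+ 2 <= '[w, L w].
    apply: le_trans (mP _ Ww); rewrite ler_wpM2r ?sqr_ge0//.
    by rewrite ge_min lexx.
  have h2 : n * `|g| ^+ 2 <= d by rewrite -ler_pdivlMr// ge_min lexx orbT.
  have h3 : `|w + t *: g| ^+ 2 <= 2 * `|w| ^+ 2 + 2 * (t ^+ 2 * `|g| ^+ 2).
    have := sqr_ge0 `|w - t *: g|.
    rewrite -!hdotE !hdot_linE (hdotC g w); lra.
  have h4 : t ^+ 2 * (n * `|g| ^+ 2) <= t ^+ 2 * d by rewrite ler_wpM2l ?sqr_ge0.
  have : n * `|w + t *: g| ^+ 2 <= n * (2 * `|w| ^+ 2 + 2 * (t ^+ 2 * `|g| ^+ 2)).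
    by rewrite ler_pM2l.
  by move: h4; rewrite expr2; lra.
- move=> x; have [p Wp pP] := Wproj x; pose s := '[x, L g] / d.
  exists (p + s *: g); first by exists p => //; exists s.
  move=> _ [w Ww [t _ <-]].
  have xp := pP _ Ww; rewrite hdotBl in xp.
  rewrite LE !hdot_linE gLw// (wLg p)// -/d.
  have -> : '[x, L g] = s * d by rewrite divfK// gt_eqF.
  have -> : '[x, L w] = '[p, L w] by apply/eqP; rewrite -subr_eq0 xp.
  by ring.
Qed.

Lemma coercive_subspace_seq (s : seq H) :
  exists2 W, coercive_subspace W & forall x, x \in s -> W x.
Proof.
elim: s => [|e s [W Wco Ws]].
  exists [set 0] => //; split => //.
  - by move=> k _ _ -> ->; rewrite scaler0 addr0.
  - by exists 1 => // _ ->; rewrite normr0 expr0n mulr0 hdot0l.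
  - by move=> e; exists 0 => // _ ->; rewrite (raddf0 L) hdot0r.
have [W' W'co [W'e WW']] := coercive_subspace_add e Wco.
exists W' => // x; rewrite inE => /orP[/eqP ->//|/Ws]; exact: WW'.
Qed.

(** Adjoining the generators one at a time takes the place of compactness of the unit sphere. *)
Lemma pd_op_coercive : finite_dimensional H ->
  exists2 m : R, 0 < m & forall h, m * `|h| ^+ 2 <= '[h, L h].
Proof.
move=> [n [e eP]].
have [W [W0 Wlin [m m0 mP] _] Ws] := coercive_subspace_seq (codom e).
exists m => // h; apply: mP; have [k ->] := eP h.
elim/big_rec: _ => // i x _ Wx; apply: Wlin => //; apply: Ws; exact: codom_f.
Qed.

End coercivity.

(** The differential is coercive with some constant [m]; near [y] the first-order remainder is at
    most m / 2 times |k|, so half of [m] survives. *)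
Lemma differentiable_strongly_monotone (R : realType) (H : hilbertType R)
    (f : H -> H) (Y : set H) y :
  open Y -> Y y -> differentiable f y -> pd_op ('d f y) -> finite_dimensional H ->
  exists m d : R, [/\ 0 < m, 0 < d & forall k, `|k| <= d ->
    Y (y + k) /\ m * `|k| ^+ 2 <= '[f (y + k) - f y, k]].
Proof.
move=> Yopen Yy df dpd Hfin.
have [m m0 mP] := pd_op_coercive dpd Hfin.
have m20 : 0 < m / 2 by rewrite divr_gt0.
have /diff_locallyP [_ /eqaddoP /(_ _ m20) fnear] := df.
have Ynear : \forall k \near (0 : H), Y (y + k).
  have : \forall z \near y, Y z by exact: open_nbhs_nbhs (conj Yopen Yy).
  by rewrite (near_shift 0) subr0; apply: filterS => h /=; rewrite addrC.
have : \forall k \near (0 : H), Y (y + k) /\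
    `|f (y + k) - f y - 'd f y k| <= m / 2 * `|k|.
  apply: filterI => //; apply: filterS fnear => k; rewrite /= !fctE /=.
  by rewrite opprD addrA (addrC k).
move=> /nbhs_ballP [d /= d0 dP].
exists (m / 2), (d / 2); split => // [|k kd]; first by rewrite divr_gt0.
have [|Yk fk] := dP k.
  rewrite -ball_normE /= sub0r normrN (le_lt_trans kd)//.
  by rewrite ltr_pdivrMr// ltr_pMr// ltr1n.
split => //.
have := hdot_norm (f (y + k) - f y - 'd f y k) k.
rewrite ler_norml => /andP[+ _]; rewrite [in X in _ <= X -> _]hdotBl.
have : `|f (y + k) - f y - 'd f y k| * `|k| <= m / 2 * `|k| ^+ 2.
  by rewrite expr2 mulrA ler_wpM2r.
have := mP k; rewrite (hdotC k); lra.
Qed.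

(** * Exponential tilting *)

(** The inequality e^(-s) >= 1 - s gives 0 <= e^s - 1 - s <= s (e^s - 1); the last factor is then
    bounded according to the sign of s. *)
Lemma expR_taylor1 (R : realType) (s : R) :
  `|expR s - 1 - s| <= s ^+ 2 * expR `|s|.
Proof.
have h1 := expR_ge1Dx s; rewrite ger0_norm; last by lra.
have h2 : expR s - 1 <= s * expR s.
  have := expR_ge1Dx (- s); rewrite -(ler_pM2r (expR_gt0 s)) -expRD addNr expR0.
  nra.
have [s0|s0] := leP 0 s.
  have : s * (expR s - 1) <= s * (s * expR s) by rewrite ler_wpM2l.
  rewrite ger0_norm//; nra.
have h3 : 1 <= expR (- s) by have := expR_ge1Dx (- s); lra.
have : s ^+ 2 <= s ^+ 2 * expR (- s) by rewrite ler_peMr ?sqr_ge0.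
have : - s * (1 - expR s) <= - s * - s by rewrite ler_wpM2l//; lra.
by rewrite (ltr0_norm s0) expr2; nra.
Qed.

(** Meant for s = c <X, h>, n = |X| and e = |h|: the right-hand side is |h|^2 times a quantity whose
    integral is finite by the moment assumption. *)
Lemma tilt_remainder_bound (R : realType) (c r n e s : R) :
  0 <= c -> 0 < r -> 0 <= n -> 0 <= e -> e <= r / 2 -> `|s| <= c * n * e ->
  (1 + n) * (s ^+ 2 * expR `|s|) <=
  2 * c / r * e ^+ 2 * ((1 + n) ^+ 2 * expR (c * r * n)).
Proof.
move=> c0 r0 n0 e0 er sc; pose E := expR (c * n * (r / 2)).
have cn0 : 0 <= c * n by rewrite mulr_ge0.
have sE : expR `|s| <= E.
  by rewrite ler_expR (le_trans sc)// ler_wpM2l.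
have s2 : s ^+ 2 <= (c * n) ^+ 2 * e ^+ 2.
  by rewrite -exprMn -real_normK ?num_real// lerXn2r// nnegrE mulr_ge0.
(* This absorbs the third moment into the exponential. *)
have cnE : c * n <= 2 / r * E.
  have := expR_ge1Dx (c * n * (r / 2)); rewrite -/E => h.
  rewrite mulrAC ler_pdivlMr//; lra.
have -> : expR (c * r * n) = E * E.
  by rewrite /E -expRD; congr expR; field.
have E0 : 0 < E := expR_gt0 _.
have h1 : s ^+ 2 * expR `|s| <= (c * n) ^+ 2 * e ^+ 2 * E.
  by rewrite ler_pM ?sqr_ge0// expR_ge0.
have h2 : (c * n) ^+ 2 * e ^+ 2 * E <= 2 * c / r * e ^+ 2 * (E * E) * n.
  have -> : (c * n) ^+ 2 * e ^+ 2 * E = (c * n * e ^+ 2 * E) * (c * n) by ring.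
  have -> : 2 * c / r * e ^+ 2 * (E * E) * n =
    (c * n * e ^+ 2 * E) * (2 / r * E) by ring.
  by rewrite ler_wpM2l// !mulr_ge0 ?sqr_ge0// ltW.
apply: (@le_trans _ _ ((1 + n) * (2 * c / r * e ^+ 2 * (E * E) * n))).
  by rewrite ler_wpM2l ?addr_ge0// (le_trans h1).
have -> : 2 * c / r * e ^+ 2 * ((1 + n) ^+ 2 * (E * E)) =
  (1 + n) * (2 * c / r * e ^+ 2 * (E * E) * (1 + n)) by ring.
rewrite ler_wpM2l ?addr_ge0// ler_wpM2l ?lerDr//.
by rewrite !mulr_ge0 ?sqr_ge0 ?invr_ge0 ?(ltW r0) ?(ltW E0).
Qed.

Ltac measurability_R := repeat first
  [ assumption
  | match goal with H : forall u, measurable_fun _ _ |- _ => exact: H end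
  | exact: measurable_cst
  | apply: measurable_funM | apply: measurable_funD | apply: measurable_funB
  | apply: measurable_funX
  | apply: (measurableT_comp (@measurable_expR _)) ].

(** * Positivity of real integrals and existence of weak integrals *)

Section integrals.
Context d (T : measurableType d) (R : realType) (H : hilbertType R).
Variable P : probability T R.

Lemma dominated_integrable (f g : T -> R) : measurable_fun setT f ->
  (forall t, `|f t| <= g t) -> P.-integrable setT (EFin \o g) ->
  P.-integrable setT (EFin \o f).
Proof.
move=> mf fg; apply: le_integrable => //; first exact/measurable_EFinP.
by move=> t _ /=; rewrite lee_fin (le_trans (fg t)) ?ler_norm.
Qed.

Lemma integrable_EFinB (f g : T -> R) : P.-integrable setT (EFin \o f) ->
  P.-integrable setT (EFin \o g) ->
  P.-integrable setT (EFin \o (fun t => f t - g t)).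
Proof. by move=> fi gi; exact: (integrableB measurableT fi gi). Qed.

Lemma integrable_EFinZl k (f : T -> R) : P.-integrable setT (EFin \o f) ->
  P.-integrable setT (EFin \o (fun t => k * f t)).
Proof. by move=> fi; exact: (integrableZl measurableT k fi). Qed.

Lemma integrable_EFinZr k (f : T -> R) : P.-integrable setT (EFin \o f) ->
  P.-integrable setT (EFin \o (fun t => f t * k)).
Proof. by move=> fi; exact: (integrableZr measurableT k fi). Qed.

Lemma measurable_level (g : T -> R) s : measurable_fun setT g ->
  measurable [set t | g t = s].
Proof.
move=> mg.
rewrite [X in measurable X](_ : _ = setT `&` g @^-1` [set s]); first exact: mg.
by rewrite setTI.
Qed.

(** A nonnegative function of zero integral vanishes almost everywhere, which would give [A]
    probability one. *)
Lemma Rintegral_gt0 (g : T -> R) (A : set T) :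
  P.-integrable setT (EFin \o g) -> (forall t, 0 <= g t) ->
  measurable A -> (forall t, g t = 0 -> A t) -> (P A < 1)%E ->
  0 < \int[P]_t g t.
Proof.
move=> gint g0 mA gA PA; rewrite lt_neqAle Rintegral_ge0// andbT eq_sym.
apply/negP => /eqP Ig0.
have : (\int[P]_t `|(EFin \o g) t| = 0)%E.
  under eq_integral do rewrite gee0_abs ?lee_fin//.
  rewrite -[LHS]fineK ?[fine _]Ig0//; exact: integrable_fin_num.
move=> /(ae_eq_integral_abs P measurableT (measurable_int P gint)).
move=> [N [mN PN NP]].
have : (P (~` A) <= P N)%E.
  apply: le_measure; rewrite ?inE//; first exact: measurableC.
  by move=> t nAt; apply: NP => /= /(_ I) [] /gA.
rewrite PN probability_setC// leNgt => /negP; apply.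
by rewrite sube_gt0.
Qed.

(** The weak integral is the Riesz representer of the linear form sending [u] to the integral of <F,
    u>, which is bounded by the integral of [D]. *)
Lemma expectation_exists (F : T -> H) (D : T -> R) :
  (forall u, measurable_fun setT (fun t => '[F t, u])) ->
  P.-integrable setT (EFin \o D) -> (forall t, `|F t| <= D t) ->
  exists v, is_expectation P F v.
Proof.
move=> mF intD FD.
have Fint u : P.-integrable setT (EFin \o (fun t => '[F t, u])).
  apply: (@dominated_integrable _ (fun t => D t * `|u|)) => // [t|].
    by rewrite (le_trans (hdot_norm _ _))// ler_wpM2r.
  exact: integrable_EFinZr.
have [|u|v vP] := @riesz R H (fun u => \int[P]_t '[F t, u]) (\int[P]_t D t).
- move=> k u v; rewrite -RintegralZl// -RintegralD//; last first.
    exact: integrable_EFinZl.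
  by apply: eq_Rintegral => t _; rewrite hdotDr hdotZr.
- apply: le_trans (le_normr_Rintegral _ (Fint u)) _ => //.
  rewrite -RintegralZr//; apply: le_Rintegral => //.
  + exact: integrable_norm.
  + exact: integrable_EFinZr.
  + by move=> t _; rewrite (le_trans (hdot_norm _ _))// ler_wpM2r.
exists v => u; split; first exact: Fint.
rewrite -vP unlock fineK//.
exact: integrable_fin_num (Fint u).
Qed.

Lemma is_expectation_dot (F : T -> H) v u :
  is_expectation P F v -> \int[P]_t '[F t, u] = '[v, u].
Proof. by move=> /(_ u)[_]; rewrite unlock /Rintegral => ->. Qed.

End integrals.

(** * Exponential tilts of a centered law *)

Section centered_tilt.
Context d (T : measurableType d) (R : realType) (H : hilbertType R).
Variables (P : probability T R) (X : T -> H) (p : T -> R) (c : R).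
Hypothesis c_ge0 : 0 <= c.
Hypothesis mX : forall u, measurable_fun setT (fun t => '[X t, u]).
Hypothesis mp : measurable_fun setT p.
Hypothesis p_gt0 : forall t, 0 < p t.
Hypothesis int_p : P.-integrable setT (EFin \o p).
Hypothesis Ip : \int[P]_t p t = 1.
Hypothesis int_Xp : forall u, P.-integrable setT (EFin \o (fun t => '[X t, u] * p t)).
Hypothesis IXp : forall u, \int[P]_t ('[X t, u] * p t) = 0.

Local Notation intR g := (P.-integrable setT (EFin \o g)).

Section mass.
Variable h : H.
Hypothesis int_pe : intR (fun t => p t * expR (c * '[X t, h])).

Lemma int_tilt_excess :
  intR (fun t => p t * (expR (c * '[X t, h]) - 1 - c * '[X t, h])).
Proof.
have := integrable_EFinB (integrable_EFinB int_pe int_p)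
  (integrable_EFinZl c (int_Xp h)).
by apply: eq_integrable => // t _ /=; congr _%:E; ring.
Qed.

(** Under [p] the constant 1 has integral 1 and <X, h> has integral 0, so only e^s - 1 - s
    contributes beyond 1. *)
Lemma tilt_excessE :
  \int[P]_t (p t * expR (c * '[X t, h])) =
  1 + \int[P]_t (p t * (expR (c * '[X t, h]) - 1 - c * '[X t, h])).
Proof.
rewrite -[X in X + _]Ip -RintegralD//; last exact: int_tilt_excess.
rewrite -[LHS]subr0 -(mulr0 c) -(IXp h) -RintegralZl// -RintegralB//.
  by apply: eq_Rintegral => t _; ring.
exact: (integrable_EFinZl c (int_Xp h)).
Qed.

Lemma tilt_excess_ge0 t : 0 <= p t * (expR (c * '[X t, h]) - 1 - c * '[X t, h]).
Proof.
rewrite mulr_ge0 ?(ltW (p_gt0 t))//.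
by have := expR_ge1Dx (c * '[X t, h]); lra.
Qed.

Lemma tilt_mass_ge1 : 1 <= \int[P]_t (p t * expR (c * '[X t, h])).
Proof.
rewrite tilt_excessE lerDl Rintegral_ge0// => t _; exact: tilt_excess_ge0.
Qed.

Lemma tilt_mass_gt1 : 0 < c -> (P [set t | '[X t, h] = 0%R] < 1)%E ->
  1 < \int[P]_t (p t * expR (c * '[X t, h])).
Proof.
move=> c0 Ph; rewrite tilt_excessE ltrDl.
apply: Rintegral_gt0 Ph => //; first exact: int_tilt_excess.
- exact: tilt_excess_ge0.
- exact: measurable_level.
move=> t /= /eqP; rewrite mulf_eq0 gt_eqF//= subr_eq0 => /eqP ht.
apply/eqP; apply: contraT => Xh0.
have cX0 : c * '[X t, h] != 0 by rewrite mulf_neq0// gt_eqF.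
by have := expR_gt1Dx cX0; lra.
Qed.

End mass.

Variable r : R.
Hypothesis r_gt0 : 0 < r.
(** A common integrable majorant, up to constants: it dominates powers of 1 + |X| up to 2 combined
    with exponential rates up to c r. *)
Let D t := (1 + `|X t|) ^+ 2 * expR (c * r * `|X t|) * p t.
Hypothesis int_D : intR D.
Let M := \int[P]_t D t.

Let D_ge n e t : (n <= 2)%N -> 0 <= e -> e <= r ->
  (1 + `|X t|) ^+ n * expR (c * e * `|X t|) * p t <= D t.
Proof.
move=> n2 e0 er; rewrite ler_wpM2r ?(ltW (p_gt0 t))// ler_pM ?expR_ge0//.
  by rewrite ler_weXn2l// lerDl.
by rewrite ler_expR ler_wpM2r// ler_wpM2l.
Qed.

Let D_ge0 t : 0 <= D t.
Proof. by rewrite !mulr_ge0 ?expR_ge0 ?sqr_ge0 ?(ltW (p_gt0 t)). Qed.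

Let X2_le t : (1 + `|X t|) ^+ 2 * p t <= D t.
Proof.
have := D_ge t (leqnn 2) (lexx 0) (ltW r_gt0).
by rewrite mulr0 mul0r expR0 mulr1.
Qed.

Let cov_le h u t : `|'[X t, h] * '[X t, u] * p t| <= D t * (`|h| * `|u|).
Proof.
rewrite normrM (gtr0_norm (p_gt0 t)) normrM.
apply: (@le_trans _ _ (`|X t| * `|h| * (`|X t| * `|u|) * p t)).
  by rewrite ler_wpM2r ?(ltW (p_gt0 t))// ler_pM// hdot_norm.
apply: (@le_trans _ _ ((1 + `|X t|) ^+ 2 * p t * (`|h| * `|u|))); last first.
  by rewrite ler_wpM2r// mulr_ge0.
rewrite [leLHS](_ : _ = `|X t| ^+ 2 * p t * (`|h| * `|u|)); last by ring.
rewrite ler_wpM2r ?mulr_ge0// ler_wpM2r ?(ltW (p_gt0 t))//.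
by rewrite lerXn2r ?nnegrE ?addr_ge0// lerDr.
Qed.

Let int_cov h u : intR (fun t => '[X t, h] * '[X t, u] * p t).
Proof.
apply: dominated_integrable (cov_le h u) _; first by measurability_R.
exact: (integrable_EFinZr _ int_D).
Qed.

Lemma integrable_covariance h u : intR (fun t => '[X t, h] * '[X t, u] * p t).
Proof. exact: int_cov. Qed.

(** [K h] is the weak integral of <X, h> p X, chosen separately for each [h]; linearity follows
    since a vector is determined by its scalar products. *)
Lemma covariance_operator : exists K : {linear H -> H},
  (forall h u, '[K h, u] = \int[P]_t ('[X t, h] * '[X t, u] * p t)) /\
  forall h, `|K h| <= M * `|h|.
Proof.
have /choice[K KP] : forall h, exists v,
    forall u, '[v, u] = \int[P]_t ('[X t, h] * '[X t, u] * p t).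
  move=> h; have [|||v vP] := @expectation_exists _ _ _ _ P
      (fun t => ('[X t, h] * p t) *: X t) (fun t => D t * `|h|).
  - move=> u; under eq_fun do rewrite hdotZl.
    by measurability_R.
  - exact: (integrable_EFinZr _ int_D).
  - move=> t; rewrite normrZ normrM (gtr0_norm (p_gt0 t)).
    apply: (@le_trans _ _ ((1 + `|X t|) ^+ 2 * p t * `|h|)); last first.
      by rewrite ler_wpM2r.
    apply: (@le_trans _ _ (`|X t| * `|h| * p t * `|X t|)).
      by rewrite ler_wpM2r// ler_wpM2r ?(ltW (p_gt0 t))// hdot_norm.
    rewrite [leLHS](_ : _ = `|X t| ^+ 2 * p t * `|h|); last by ring.
    rewrite ler_wpM2r// ler_wpM2r ?(ltW (p_gt0 t))//.
    by rewrite lerXn2r ?nnegrE ?addr_ge0// lerDr.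
  exists v => u; rewrite -(is_expectation_dot u vP).
  by apply: eq_Rintegral => t _; rewrite hdotZl mulrAC.
have Klin : linear K.
  move=> k h1 h2; apply: hdotP => u; rewrite hdotDl hdotZl !KP.
  rewrite -RintegralZl// -RintegralD//; last first.
    exact: (integrable_EFinZl k (int_cov _ _)).
  by apply: eq_Rintegral => t _; rewrite hdotDr hdotZr; ring.
pose K' : {linear H -> H} :=
  HB.pack K (GRing.isLinear.Build R H H *:%R K Klin).
exists K'; split => //= h; apply: norm_le_hdot => [|u].
  by rewrite mulr_ge0// Rintegral_ge0.
rewrite KP (le_trans (ler_norm _))// (le_trans (le_normr_Rintegral _ _))//.
rewrite -mulrA -RintegralZr//; apply: le_Rintegral => //.
- exact: integrable_norm.
- exact: (integrable_EFinZr _ int_D).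
Qed.

Let rem_le h : `|h| <= r / 2 -> forall t,
  (1 + `|X t|) * `|p t * (expR (c * '[X t, h]) - 1 - c * '[X t, h])| <=
  D t * (2 * c / r * `|h| ^+ 2).
Proof.
move=> hr t; rewrite normrM (gtr0_norm (p_gt0 t)).
have := @tilt_remainder_bound R c r `|X t| `|h| (c * '[X t, h]) c_ge0 r_gt0
  (normr_ge0 _) (normr_ge0 _) hr.
rewrite normrM (ger0_norm c_ge0) -mulrA => /(_ _).
rewrite ler_wpM2l ?hdot_norm// => /(_ isT) h1.
have := expR_taylor1 (c * '[X t, h]); rewrite normrM (ger0_norm c_ge0) => h2.
apply: (@le_trans _ _ (2 * c / r * `|h| ^+ 2 *
    ((1 + `|X t|) ^+ 2 * expR (c * r * `|X t|)) * p t)); last first.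
  by rewrite /D le_eqVlt; apply/orP; left; apply/eqP; ring.
rewrite mulrCA mulrC ler_wpM2r ?(ltW (p_gt0 t))//.
by rewrite (le_trans _ h1)// ler_wpM2l// addr_ge0.
Qed.

Let int_tilt h : `|h| <= r / 2 -> intR (fun t => p t * expR (c * '[X t, h])).
Proof.
move=> hr; apply: (@dominated_integrable _ _ _ _ _ D) => //.
  by measurability_R.
move=> t; rewrite ger0_norm ?mulr_ge0 ?expR_ge0 ?(ltW (p_gt0 t))//.
have r2 : r / 2 <= r by rewrite ler_pdivrMr// ler_peMr ?(ltW r_gt0)// ler1n.
apply: le_trans (D_ge t (isT : 0 <= 2)%N (divr_ge0 (ltW r_gt0) _) r2) => //.
rewrite expr0 mul1r mulrC ler_wpM2r ?(ltW (p_gt0 t))// ler_expR.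
rewrite -mulrA ler_wpM2l// mulrC (le_trans (hdot_ler _ _))//.
by rewrite ler_wpM2l.
Qed.

Let int_Xtilt h u : `|h| <= r / 2 ->
  intR (fun t => '[X t, u] * (p t * expR (c * '[X t, h]))).
Proof.
move=> hr; apply: (@dominated_integrable _ _ _ _ _ (fun t => D t * `|u|)) => //.
- by measurability_R.
- move=> t; rewrite normrM.
  rewrite (@ger0_norm _ (p t * _)) ?mulr_ge0 ?expR_ge0 ?(ltW (p_gt0 t))//.
  have r2 : r / 2 <= r by rewrite ler_pdivrMr// ler_peMr ?(ltW r_gt0)// ler1n.
  apply: (@le_trans _ _ (`|X t| * `|u| * (p t * expR (c * (r / 2) * `|X t|)))).
    rewrite ler_pM ?hdot_norm ?mulr_ge0 ?expR_ge0 ?(ltW (p_gt0 t))//.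
    rewrite ler_wpM2l ?(ltW (p_gt0 t))// ler_expR -mulrA ler_wpM2l//.
    by rewrite mulrC (le_trans (hdot_ler _ _))// ler_wpM2l.
  rewrite [leLHS](_ : _ = `|X t| * expR (c * (r / 2) * `|X t|) * p t * `|u|); last by ring.
  rewrite ler_wpM2r//.
  apply: le_trans (D_ge t (isT : 1 <= 2)%N (divr_ge0 (ltW r_gt0) _) r2) => //.
  by rewrite expr1 ler_wpM2r ?(ltW (p_gt0 t))// ler_wpM2r ?expR_ge0// lerDr.
- exact: (integrable_EFinZr _ int_D).
Qed.

(** [k] is the mean of X under the law tilted by [h], and [A] is the mass of the tilt. As X has mean
    zero under [p], A k - c K h is the integral of X p (e^s - 1 - s), of order |h|^2; so is A - 1,
    and A >= 1 allows dividing by [A]. *)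
Lemma tilt_mean_quadratic (K : {linear H -> H}) :
  (forall h u, '[K h, u] = \int[P]_t ('[X t, h] * '[X t, u] * p t)) ->
  (forall h, `|K h| <= M * `|h|) ->
  exists C : R, forall h k, `|h| <= r / 2 ->
    (forall u, \int[P]_t ('[X t, u] * (p t * expR (c * '[X t, h]))) =
       '[k, u] * \int[P]_t (p t * expR (c * '[X t, h]))) ->
    `|k - c *: K h| <= C * `|h| ^+ 2.
Proof.
move=> KE KM; pose C := M * (2 * c / r).
have M0 : 0 <= M by rewrite Rintegral_ge0.
have C0 : 0 <= C by rewrite !mulr_ge0 ?invr_ge0// ltW.
(* The first [C] bounds A k - c K h; the product bounds (A - 1) c K h, using |c K h| <= c M r /
   2. *)
exists (C + C * (c * M * (r / 2))) => h k hr kE.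
set A := \int[P]_t (p t * expR (c * '[X t, h])) in kE.
have A1 : 1 <= A by apply: tilt_mass_ge1; exact: int_tilt.
have AC : A - 1 <= C * `|h| ^+ 2.
  rewrite /A tilt_excessE; last exact: int_tilt.
  rewrite addrAC subrr add0r /C -mulrA -RintegralZr//.
  apply: le_Rintegral => //.
  - by apply: int_tilt_excess; exact: int_tilt.
  - exact: (integrable_EFinZr _ int_D).
  - move=> t _; apply: le_trans (rem_le hr t).
    by apply: le_trans (ler_norm _) _; rewrite ler_peMl// lerDl.
have kC : `|A *: k - c *: K h| <= C * `|h| ^+ 2.
  apply: norm_le_hdot => [|u]; first by rewrite mulr_ge0// sqr_ge0.
  have int_c := integrable_EFinZl c (int_cov h u).
  rewrite hdotBl !hdotZl mulrC -kE KE -RintegralZl//.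
  rewrite -[X in X - _]subr0 -(IXp u) -RintegralB//; last exact: int_Xtilt.
  have int_1 : intR (fun t => '[X t, u] * (p t * expR (c * '[X t, h])) - '[X t, u] * p t).
    exact: (integrable_EFinB (int_Xtilt u hr) (int_Xp u)).
  rewrite -RintegralB//.
  apply: le_trans (ler_norm _) _.
  apply: le_trans (le_normr_Rintegral _ _) _ => //.
    exact: (integrable_EFinB int_1 int_c).
  rewrite /C -!mulrA -RintegralZr//; apply: le_Rintegral => //.
  - apply: integrable_norm; exact: (integrable_EFinB int_1 int_c).
  - exact: (integrable_EFinZr _ int_D).
  move=> t _.
  rewrite [X in `|X|](_ : _ =
    '[X t, u] * (p t * (expR (c * '[X t, h]) - 1 - c * '[X t, h]))); last by ring.
  rewrite normrM.
  apply: (@le_trans _ _ ((1 + `|X t|) *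
     `|p t * (expR (c * '[X t, h]) - 1 - c * '[X t, h])| * `|u|)).
    rewrite mulrAC ler_wpM2r// (le_trans (hdot_norm _ _))// ler_wpM2r//.
    by rewrite lerDr.
  rewrite (le_trans (ler_wpM2r _ (rem_le hr t)))//.
  by rewrite le_eqVlt; apply/orP; left; apply/eqP; ring.
have KC : `|c *: K h| <= c * M * (r / 2).
  rewrite normrZ (ger0_norm c_ge0) -mulrA ler_wpM2l// (le_trans (KM h))//.
  by rewrite ler_wpM2l.
have A0 : 0 < A by apply: lt_le_trans A1.
apply: (@le_trans _ _ (A * `|k - c *: K h|)); first by rewrite ler_peMl.
rewrite -[X in X * `|_|](gtr0_norm A0) -normrZ.
have -> : A *: (k - c *: K h) = (A *: k - c *: K h) - (A - 1) *: (c *: K h).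
  by rewrite scalerBr scalerBl scale1r opprB addrA subrK.
apply: le_trans (ler_normB _ _) _; rewrite mulrDl lerD//.
by rewrite normrZ ger0_norm ?subr_ge0// mulrAC ler_pM// subr_ge0.
Qed.

End centered_tilt.

(** * Mass, mean and differential along a family of tilted densities *)

Section tilted_family.
Context d (T : measurableType d) (R : realType) (H : hilbertType R).
Variables (P : probability T R) (xi : T -> H) (q : T -> H -> R) (Y : set H).
Variables (b : H -> R) (c : R) (f : H -> H).
Local Notation intR g := (P.-integrable setT (EFin \o g)).
Let Q y := \int[P]_t q t y.
Hypothesis Yopen : open Y.
Hypothesis c_ge0 : 0 <= c.
Hypothesis mxi : forall u, measurable_fun setT (fun t => '[xi t, u]).
Hypothesis mq : forall y, Y y -> measurable_fun setT (q ^~ y).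
Hypothesis q_gt0 : forall t y, Y y -> 0 < q t y.
Hypothesis q_tilt : forall t y z, Y y -> Y z ->
  q t z = expR (b y - b z + c * '[xi t, z - y]) * q t y.
Hypothesis q_moment : forall y, Y y -> exists2 r : R, 0 < r &
  intR (fun t => (1 + `|xi t|) ^+ 2 * expR (c * r * `|xi t|) * q t y).
Hypothesis fE : forall y u, Y y ->
  \int[P]_t ('[xi t, u] * q t y) = '[f y, u] * Q y.

(** Measurability of the norm is a separate assumption: in a nonseparable space it does not follow
    from that of the scalar products. *)
Lemma int_moment1 y : Y y -> measurable_fun setT (fun t => `|xi t|) ->
  intR (fun t => (1 + `|xi t|) * q t y).
Proof.
move=> Yy mn; have [r r0 int2] := q_moment Yy.
apply: dominated_integrable int2 => [|t].
  by have := mq Yy; measurability_R.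
rewrite ger0_norm ?mulr_ge0 ?addr_ge0 ?(ltW (q_gt0 _ Yy))//.
rewrite ler_wpM2r ?(ltW (q_gt0 _ Yy))// expr2 -mulrA ler_peMr ?addr_ge0//.
by rewrite mulr_ege1// ?lerDl// -expR0 ler_expR !mulr_ge0// ltW.
Qed.

Lemma int_mass y : Y y -> intR (q ^~ y).
Proof.
move=> Yy; have [r r0 int2] := q_moment Yy.
apply: dominated_integrable int2 => [|t]; first exact: mq.
rewrite ger0_norm ?(ltW (q_gt0 _ Yy))// ler_peMl ?(ltW (q_gt0 _ Yy))//.
by rewrite mulr_ege1// ?exprn_ege1 ?lerDl// -expR0 ler_expR !mulr_ge0// ltW.
Qed.

Lemma int_mean y u : Y y -> intR (fun t => '[xi t, u] * q t y).
Proof.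
move=> Yy; have [r r0 int2] := q_moment Yy.
apply: dominated_integrable (integrable_EFinZr `|u| int2) => [|t].
  by have := mq Yy; measurability_R.
rewrite normrM (gtr0_norm (q_gt0 _ Yy)) mulrAC.
rewrite ler_wpM2r ?(ltW (q_gt0 _ Yy))// (le_trans (hdot_norm _ _))//.
rewrite ler_wpM2r// (@le_trans _ _ (1 + `|xi t|))// ?lerDr//.
rewrite expr2 -mulrA ler_peMr ?addr_ge0//.
by rewrite mulr_ege1// ?lerDl// -expR0 ler_expR !mulr_ge0// ltW.
Qed.

Lemma mass_gt0 y : Y y -> 0 < Q y.
Proof.
move=> Yy; apply: (@Rintegral_gt0 _ _ _ _ _ set0) => //.
- exact: int_mass.
- by move=> t; rewrite ltW ?q_gt0.
- by move=> t /eqP; rewrite gt_eqF ?q_gt0.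
- by rewrite measure0 lte01.
Qed.

Section at_point.
Variables (y : H) (Yy : Y y).
Let X t := xi t - f y.
Let p t := q t y / Q y.
Let Qy0 := mass_gt0 Yy.

Let mX u : measurable_fun setT (fun t => '[X t, u]).
Proof. by rewrite /X; under eq_fun do rewrite hdotBl; measurability_R. Qed.

Let mp : measurable_fun setT p.
Proof. exact: (measurable_funM (mq Yy) (measurable_cst _)). Qed.

Let p_gt0 t : 0 < p t.
Proof. by rewrite divr_gt0// q_gt0. Qed.

Let int_p : intR p.
Proof. by apply: integrable_EFinZr; exact: int_mass. Qed.

Let Ip : \int[P]_t p t = 1.
Proof. by rewrite RintegralZr ?divff ?gt_eqF//; exact: int_mass. Qed.

Let int_shift u z : Y z -> intR (fun t => '[X t, u] * q t z).
Proof.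
move=> Yz.
have := integrable_EFinB (int_mean u Yz) (integrable_EFinZl '[f y, u] (int_mass Yz)).
by apply: eq_integrable => // t _ /=; rewrite hdotBl mulrBl.
Qed.

Let shift_mean u z : Y z ->
  \int[P]_t ('[X t, u] * q t z) = '[f z - f y, u] * Q z.
Proof.
move=> Yz; rewrite hdotBl mulrBl -fE// /Q -RintegralZl//; last exact: int_mass.
rewrite -RintegralB//; first 1 last.
- exact: int_mean.
- by apply: integrable_EFinZl; exact: int_mass.
by apply: eq_Rintegral => t _; rewrite hdotBl mulrBl.
Qed.

Let XpE u : (fun t => '[X t, u] * p t) = (fun t => ('[X t, u] * q t y) / Q y).
Proof. by apply: funext => t; rewrite mulrA. Qed.

Let int_Xp u : intR (fun t => '[X t, u] * p t).
Proof. by rewrite XpE; apply: integrable_EFinZr; exact: int_shift. Qed.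

Let IXp u : \int[P]_t ('[X t, u] * p t) = 0.
Proof.
under eq_Rintegral do rewrite mulrA.
rewrite RintegralZr//; last exact: int_shift.
by rewrite shift_mean// subrr hdot0l !mul0r.
Qed.

(** The factor, constant in [t], relating q(z|.) to the tilt of [p] by z - y; it collects the [b]
    terms, the recentering at [f y] and the normalization. The tilt thus has mass [k z * Q z] and
    mean [f z - f y]. *)
Let k z := expR (b z - b y - c * '[f y, z - y]) / Q y.

Let tiltE z t : Y z -> p t * expR (c * '[X t, z - y]) = k z * q t z.
Proof.
move=> Yz; rewrite (q_tilt t Yy Yz) /p /k.
set e := _ - _ - _.
have -> : expR (c * '[X t, z - y]) = expR e * expR (b y - b z + c * '[xi t, z - y]).
  by rewrite -expRD /e /X hdotBl; congr expR; ring.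
by ring.
Qed.

Let int_tilt z : Y z -> intR (fun t => p t * expR (c * '[X t, z - y])).
Proof.
move=> Yz; rewrite (_ : (fun t => _) = (fun t => k z * q t z)).
  by apply: integrable_EFinZl; exact: int_mass.
by apply: funext => t; rewrite tiltE.
Qed.

Let tilt_mass z : Y z -> \int[P]_t (p t * expR (c * '[X t, z - y])) = k z * Q z.
Proof.
move=> Yz; rewrite -RintegralZl//; last exact: int_mass.
by apply: eq_Rintegral => t _; rewrite tiltE.
Qed.

Let tilt_mean z u : Y z ->
  \int[P]_t ('[X t, u] * (p t * expR (c * '[X t, z - y]))) =
  '[f z - f y, u] * \int[P]_t (p t * expR (c * '[X t, z - y])).
Proof.
move=> Yz; rewrite tilt_mass// mulrCA -shift_mean// -RintegralZl//; last first.
  exact: int_shift.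
by apply: eq_Rintegral => t _; rewrite tiltE// mulrCA.
Qed.

(** The logarithm of [k z * Q z] >= 1; adding [b] to [ln (Q _)] recovers ln Z. *)
Lemma log_mass_ge z : Y z -> ln (Q y) + b y + c * '[f y, z - y] <= ln (Q z) + b z.
Proof.
move=> Yz.
have := tilt_mass_ge1 p_gt0 int_p Ip int_Xp IXp (int_tilt Yz).
rewrite tilt_mass// /k mulrAC ler_pdivlMr// mul1r.
rewrite -ler_ln ?posrE ?mulr_gt0 ?expR_gt0 ?mass_gt0// lnM ?posrE ?expR_gt0 ?mass_gt0//.
by rewrite expRK; lra.
Qed.

Lemma log_mass_gt z : Y z -> 0 < c ->
  (forall u s, u != 0 -> (P [set t | '[xi t, u] = s] < 1)%E) ->
  z != y -> ln (Q y) + b y + c * '[f y, z - y] < ln (Q z) + b z.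
Proof.
move=> Yz c0 nondeg zy.
have := tilt_mass_gt1 mX p_gt0 int_p Ip int_Xp IXp (int_tilt Yz) c0.
rewrite [X in P X](_ : _ = [set t | '[xi t, z - y] = '[f y, z - y]]); last first.
  apply/seteqP; split => t /=; rewrite hdotBl => /eqP.
    by rewrite subr_eq0 => /eqP.
  by rewrite -subr_eq0 => /eqP.
rewrite nondeg ?subr_eq0// => /(_ isT).
rewrite tilt_mass// /k mulrAC ltr_pdivlMr// mul1r.
rewrite -ltr_ln ?posrE ?mulr_gt0 ?expR_gt0 ?mass_gt0// lnM ?posrE ?expR_gt0 ?mass_gt0//.
by rewrite expRK; lra.
Qed.

Lemma mean_constant z : c = 0 -> Y z -> f z = f y.
Proof.
move=> c0 Yz; apply: hdotP => u; apply/eqP; rewrite -subr_eq0 -hdotBl.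
have := tilt_mean u Yz.
have -> : \int[P]_t ('[X t, u] * (p t * expR (c * '[X t, z - y]))) = 0.
  by rewrite -(IXp u); apply: eq_Rintegral => t _; rewrite c0 mul0r expR0 mulr1.
move=> /esym/eqP; rewrite mulf_eq0 => /orP[//|].
rewrite gt_eqF// (lt_le_trans ltr01)//.
exact: (tilt_mass_ge1 p_gt0 int_p Ip int_Xp IXp (int_tilt Yz)).
Qed.

Hypothesis mnorm : measurable_fun setT (fun t => `|X t|).

Lemma mean_differential : exists K : {linear H -> H},
  [/\ is_diff y f (c \*: K), continuous (c \*: K),
   forall h u, intR (fun t => '[X t, h] * '[X t, u] * p t) &
   forall h u, '[K h, u] = \int[P]_t ('[X t, h] * '[X t, u] * p t)].
Proof.
have [r r0 int2] := q_moment Yy.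
(* The moment bound survives centering up to a constant, through 1 + |X| <= (1 + |f y|) (1 + |xi|)
   and the triangle inequality in the exponent. *)
have int_D : intR (fun t => (1 + `|X t|) ^+ 2 * expR (c * r * `|X t|) * p t).
  apply: dominated_integrable (integrable_EFinZl
    ((1 + `|f y|) ^+ 2 * expR (c * r * `|f y|) / Q y) int2) => [|t].
    by measurability_R.
  rewrite ger0_norm; last first.
    exact: mulr_ge0 (mulr_ge0 (sqr_ge0 _) (expR_ge0 _)) (ltW (p_gt0 t)).
  have Xn : `|X t| <= `|xi t| + `|f y| by exact: ler_normB.
  have h1 : (1 + `|X t|) ^+ 2 <= (1 + `|f y|) ^+ 2 * (1 + `|xi t|) ^+ 2.
    rewrite -exprMn lerXn2r ?nnegrE ?mulr_ge0 ?addr_ge0//.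
    have : 0 <= `|f y| * `|xi t| by rewrite mulr_ge0.
    nra.
  have h2 : expR (c * r * `|X t|) <= expR (c * r * `|f y|) * expR (c * r * `|xi t|).
    rewrite -expRD ler_expR -mulrDr ler_wpM2l ?mulr_ge0 ?(ltW r0)//.
    by rewrite addrC.
  have h3 := ler_pM (sqr_ge0 _) (expR_ge0 _) h1 h2.
  rewrite (le_trans (ler_wpM2r (ltW (p_gt0 t)) h3))//.
  by rewrite le_eqVlt; apply/orP; left; apply/eqP; rewrite /p; ring.
have [K [KE KM]] := covariance_operator c_ge0 mX mp p_gt0 r0 int_D.
have cK : continuous (c \*: K).
  apply: bounded_linear_continuous; apply/linear_boundedP.
  exists (c * \int[P]_t ((1 + `|X t|) ^+ 2 * expR (c * r * `|X t|) * p t)).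
  split; first exact: num_real.
  move=> s /ltW Ms h; rewrite /= normrZ (ger0_norm c_ge0).
  apply: le_trans (ler_wpM2l c_ge0 (KM h)) _.
  by rewrite mulrA ler_wpM2r.
exists K; split => //; last first.
  by move=> h u; exact: (integrable_covariance c_ge0 mX mp p_gt0 r0 int_D h u).
have [C CP] := tilt_mean_quadratic c_ge0 mX mp p_gt0 int_p Ip int_Xp IXp r0 int_D KE KM.
apply: (is_diff_quadratic (C := C) cK).
have r20 : 0 < r / 2 by rewrite divr_gt0.
have Ynear : \forall h \near (0 : H), Y (y + h).
  have : \forall z \near y, Y z by exact: open_nbhs_nbhs (conj Yopen Yy).
  by rewrite (near_shift 0) subr0; apply: filterS => h /=; rewrite addrC.
near=> h; rewrite /=; apply: CP => [|u].
  by rewrite ltW//; near: h; exact: nbhs0_lt.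
have Yh : Y (y + h) by near: h.
by have := tilt_mean u Yh; rewrite (addrC y h) addrK.
Unshelve. all: by end_near. Qed.

Lemma mean_psd : differentiable f y /\ psd_op ('d f y).
Proof.
have [K [[df dE] cK _ KE]] := mean_differential.
split => //; split; first split.
- by rewrite dE.
- by move=> x u; rewrite dE /= hdotZr hdotZl hdotC !KE;
    congr (_ * _); apply: eq_Rintegral => t _; rewrite (mulrC '[X t, u]).
- move=> x; rewrite dE /= hdotZr hdotC KE mulr_ge0// Rintegral_ge0// => t _.
  by rewrite mulr_ge0 ?(ltW (p_gt0 t))// -expr2 sqr_ge0.
Qed.

(** The integrand <X, x>^2 p of the quadratic form vanishes only on the hyperplane <xi, x> = <f y,
    x>, which has probability less than one. *)
Lemma mean_pd : 0 < c ->
  (forall u s, u != 0 -> (P [set t | '[xi t, u] = s] < 1)%E) ->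
  pd_op ('d f y).
Proof.
move=> c0 nondeg; have [K [[_ dE] _ int_K KE]] := mean_differential.
split; first by case: mean_psd => _ [].
move=> x x0; rewrite dE /= hdotZr hdotC KE mulr_gt0//.
apply: (@Rintegral_gt0 _ _ _ _ _ [set t | '[xi t, x] = '[f y, x]]).
- exact: int_K.
- by move=> t; rewrite mulr_ge0 ?(ltW (p_gt0 t))// -expr2 sqr_ge0.
- exact: measurable_level.
- move=> t /eqP; rewrite mulf_eq0 (gt_eqF (p_gt0 t)) orbF mulf_eq0 orbb /X.
  by rewrite hdotBl subr_eq0 => /eqP.
- exact: nondeg.
Qed.

End at_point.

(** For c = 0 the tilt is trivial and [f] is constant on [Y], so z -> <f z, z> agrees there with a
    linear function whose gradient is that constant. *)
Lemma mean_subgradient : exists psi : H -> R, forall y z, Y y -> Y z ->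
  psi y + '[f y, z - y] <= psi z.
Proof.
have [c0|] := eqVneq c 0.
  exists (fun z => '[f z, z]) => y z Yy Yz.
  by rewrite (mean_constant Yy c0 Yz) hdotBr addrC subrK.
rewrite neq_lt ltNge c_ge0/= => c0.
exists (fun z => (ln (Q z) + b z) / c) => y z Yy Yz.
rewrite -(ler_pM2r c0) mulrDl !divfK ?gt_eqF// (mulrC _ c).
exact: log_mass_ge.
Qed.

(** If two distinct points had the same image, the strict subgradient inequalities at both would add
    up to 0 < 0. *)
Lemma mean_injective : 0 < c ->
  (forall u s, u != 0 -> (P [set t | '[xi t, u] = s] < 1)%E) ->
  {in Y &, injective f}.
Proof.
move=> c0 nondeg y z; rewrite !inE => Yy Yz fyz.
apply/eqP; apply: contraT => yz.
have zy : z != y by rewrite eq_sym.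
have := log_mass_gt Yy Yz c0 nondeg zy; have := log_mass_gt Yz Yy c0 nondeg yz.
by rewrite fyz -(opprB z y) hdotNr; lra.
Qed.

End tilted_family.

(** * Posterior means *)

Section borel_subset_measurable.
Context (R : realType) (H : hilbertType R) (X : set H) (x0 : X).

(** Preimages of open intervals are relatively open in [X], hence generators of the sigma-algebra,
    whether or not [X] is Borel. *)
Lemma measurable_borel_subset (g : H -> R) : continuous g ->
  measurable_fun setT (fun x : borel_subset x0 => g (set_val x)).
Proof.
move=> gc; apply: (measurability _ (RGenOpens.measurableE R)) => //.
move=> _ [_ [s [t ->]] <-]; rewrite setTI; apply: sub_sigma_algebra.
exists (g @^-1` `]s, t[%classic) => //; apply: open_comp => // x _; exact: gc.
Qed.

Lemma continuous_hdotl (u : H) : continuous (fun x : H => '[x, u]).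
Proof.
move=> x; apply/cvgrPdist_lt => e e0.
have u0 : 0 < `|u| + 1 by rewrite ltr_wpDl.
near=> z; rewrite -hdotBl (le_lt_trans (hdot_norm _ _))//.
apply: (@le_lt_trans _ _ (`|x - z| * (`|u| + 1))); first by rewrite ler_wpM2l// lerDl.
rewrite -ltr_pdivlMr//; near: z.
by apply: cvgr_dist_lt; [exact: cvg_id|rewrite divr_gt0].
Unshelve. all: by end_near. Qed.

End borel_subset_measurable.

Section posterior.
Context (R : realType) (H : hilbertType R) (X : set H) (x0 : X) (Y : set H).
Variables (c : R) (a : X -> R) (b : H -> R) (q : X -> H -> R).
Variable P : probability (borel_subset x0) R.
Hypothesis c_ge0 : 0 <= c.
Hypothesis qE : forall (x : X) (y : H), Y y ->
  q x y = expR (- a x - b y + c * '[set_val x, y]).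
Hypothesis P_moment : forall y : H, Y y -> exists2 r : R, 0 < r &
  P.-integrable setT (fun x : borel_subset x0 =>
    ((1 + `|set_val x|) ^+ 2 *
      expR (- a x + c * r * `|set_val x| + c * '[set_val x, y]))%:E).

Lemma measurable_hdot_val u :
  measurable_fun setT (fun x : borel_subset x0 => '[set_val x, u]).
Proof.
apply: (@measurable_borel_subset _ _ _ _ (fun x => '[x, u])).
exact: continuous_hdotl.
Qed.

Lemma measurable_norm_val v :
  measurable_fun setT (fun x : borel_subset x0 => `|set_val x - v|).
Proof.
apply: (@measurable_borel_subset _ _ _ _ (fun x => `|x - v|)) => x.
by apply: cvg_norm; apply: cvgB; [exact: cvg_id|exact: cvg_cst].
Qed.

Lemma density_gt0 x y : Y y -> 0 < q x y.
Proof. by move=> Yy; rewrite qE// expR_gt0. Qed.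

Lemma density_tilt x y z : Y y -> Y z ->
  q x z = expR (b y - b z + c * '[set_val x, z - y]) * q x y.
Proof.
by move=> Yy Yz; rewrite !qE// -expRD hdotBr; congr expR; ring.
Qed.

Lemma density_moment y : Y y -> exists2 r : R, 0 < r &
  P.-integrable setT (EFin \o (fun x : borel_subset x0 => (1 + `|set_val x|) ^+ 2 *
    expR (c * r * `|set_val x|) * q x y)).
Proof.
move=> Yy; have [r r0 int2] := P_moment Yy; exists r => //.
have := integrable_EFinZl (expR (- b y)) int2.
apply: eq_integrable => // x _ /=; congr _%:E; rewrite qE// mulrCA -expRD -[RHS]mulrA -expRD.
by congr (_ * expR _); ring.
Qed.

(* [a] inherits measurability from the integrand of [P_moment]. *)
Lemma measurable_density y : Y y ->
  measurable_fun setT (fun x : borel_subset x0 => q x y).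
Proof.
move=> Yy; have [r r0 /(measurable_int P) /measurable_EFinP m2] := density_moment Yy.
pose g (x : H) := ((1 + `|x|) ^+ 2 * expR (c * r * `|x|))^-1.
have g0 x : 0 < (1 + `|x|) ^+ 2 * expR (c * r * `|x|).
  by rewrite mulr_gt0 ?expR_gt0// exprn_gt0// ltr_pwDl.
rewrite (_ : (fun x : borel_subset x0 => q x y) =
    (fun x : borel_subset x0 =>
      (1 + `|set_val x|) ^+ 2 * expR (c * r * `|set_val x|) * q x y) \*
    (fun x : borel_subset x0 => g (set_val x))); last first.
  by apply: funext => x /=; rewrite /g mulrC mulKf// gt_eqF.
apply: measurable_funM => //; apply: measurable_borel_subset => x.
apply: cvgV; first by rewrite gt_eqF.
have nc : `|z| @[z --> x] --> `|x| by apply: cvg_norm; exact: cvg_id.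
have n1 : 1 + `|z| @[z --> x] --> 1 + `|x| by apply: cvgD => //; exact: cvg_cst.
have n2 : (1 + `|z|) ^+ 2 @[z --> x] --> (1 + `|x|) ^+ 2 by exact: cvgM.
have e1 : c * r * `|z| @[z --> x] --> c * r * `|x|.
  by apply: cvgM => //; exact: cvg_cst.
have e2 : expR (c * r * `|z|) @[z --> x] --> expR (c * r * `|x|).
  exact: (continuous_cvg _ (@continuous_expR R _) e1).
exact: cvgM.
Qed.

Lemma posterior_expectation y : Y y -> exists v : H,
  is_expectation P (fun x : borel_subset x0 => q x y *: set_val x) v.
Proof.
move=> Yy.
have mn : measurable_fun setT (fun x : borel_subset x0 => `|set_val x|).
  by have := measurable_norm_val 0; under eq_fun do rewrite subr0.
apply: (expectation_exists _ (int_moment1 c_ge0 (@measurable_density) density_gt0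
  density_moment Yy mn)) => [u|x].
  under eq_fun do rewrite hdotZl.
  apply: measurable_funM; first exact: measurable_density.
  exact: measurable_hdot_val.
rewrite normrZ (gtr0_norm (density_gt0 _ Yy)) mulrC ler_wpM2r ?lerDr//.
by rewrite ltW ?density_gt0.
Qed.

Lemma marginalE y : marginal P q y = \int[P]_x q x y.
Proof. by rewrite /marginal unlock. Qed.

Lemma posterior_meanE y u : Y y ->
  \int[P]_x ('[set_val x, u] * q x y) =
  '[posterior_mean P q y, u] * \int[P]_x q x y.
Proof.
move=> Yy; have [v vP] := posterior_expectation Yy.
have Q0 := mass_gt0 (Y := Y) c_ge0 (@measurable_density) density_gt0 density_moment Yy.
rewrite /posterior_mean marginalE hdotZl mulrAC mulVf ?gt_eqF// mul1r.
have /(is_expectation_dot u) <- : is_expectation P (fun x : borel_subset x0 =>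
    q x y *: set_val x) (expectationH P (fun x : borel_subset x0 => q x y *: set_val x)).
  (* Existence guarantees that [get] returns an actual expectation and not its default value. *)
  by apply: getPex; exists v.
by apply: eq_Rintegral => x _; rewrite hdotZl mulrC.
Qed.

End posterior.

Theorem lemma5 (R : realType) (H : hilbertType R) (X : set H) (x0 : X)
  (Y : set H) (Yopen : open Y) (Yconvex : convex_set (Y : set (convex_lmodType H)))
  (c : R) (c_ge0 : 0 <= c) (a : X -> R) (b : H -> R)
  (bC1 : C1_on Y b) (b'_bounded : diff_locally_bounded Y b)
  (q : X -> H -> R)
  (qE : forall (x : X) (y : H), Y y ->
     q x y = expR (- a x - b y + c * '[set_val x, y]))
  (P : probability (borel_subset x0) R)
  (P_moment : forall y : H, Y y -> exists2 r : R, 0 < r &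
     P.-integrable setT (fun x : borel_subset x0 =>
       ((1 + `|set_val x|) ^+ 2 *
        expR (- a x + c * r * `|set_val x| + c * '[set_val x, y]))%:E)) :
  let q_P := marginal P q in
  let Y_P := [set y | Y y /\ 0 < q_P y] in
  let f_P := posterior_mean P q in
  [/\ (forall y, Y y ->
        P.-integrable setT (fun x : borel_subset x0 =>
          ((1 + `|set_val x|) * q x y)%:E) /\
        exists v : H,
          is_expectation P (fun x : borel_subset x0 => q x y *: set_val x) v),
      Y_P = Y,
      (forall y, Y_P y -> differentiable f_P y),
      (forall y, Y y -> psd_op ('d f_P y)) &
      exists2 phi_P : H -> \bar R, penalty phi_P & implements_prox Y f_P phi_P]
  /\
  (0 < c ->
   (forall (u : H) (d : R), u != 0 ->
      (P [set x : borel_subset x0 | '[set_val x, u] = d] < 1)%E) ->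
   exists2 phi_P : H -> \bar R, penalty phi_P &
     [/\ (forall y, Y y -> pd_op ('d f_P y)),
         {in Y &, injective f_P},
         is_prox Y f_P phi_P,
         (forall y u, Y y -> stationary (prox_obj phi_P y) u -> u = f_P y) &
         finite_dimensional H ->
           forall y, Y y -> stationary (prox_obj phi_P y) (f_P y)]).
Proof.
move=> q_P Y_P f_P.
have mh := @measurable_hdot_val R H X x0.
have md := measurable_density qE P_moment.
have q0 := density_gt0 qE.
have qt := density_tilt qE.
have qm := density_moment qE P_moment.
have fE y u := posterior_meanE c_ge0 qE P_moment u (y := y).
have mn (y : H) := @measurable_norm_val R H X x0 (f_P y).
have mass0 y : Y y -> 0 < q_P y.
  by move=> Yy; rewrite /q_P marginalE; exact: (mass_gt0 c_ge0 md q0 qm Yy).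
have YPE : Y_P = Y.
  by apply/seteqP; split => y //= => [[]//|Yy]; split => //; exact: mass0.
have diffP y : Y y -> differentiable f_P y /\ psd_op ('d f_P y).
  by move=> Yy; exact: (mean_psd Yopen c_ge0 mh md q0 qt qm fE Yy (mn y)).
have [psi psiP] : exists psi : H -> R, forall y z, Y y -> Y z ->
    psi y + '[f_P y, z - y] <= psi z.
  exact: (mean_subgradient c_ge0 mh md q0 qt qm fE).
have fcont y : Y y -> {for y, continuous f_P}.
  by move=> /diffP[df _]; exact: differentiable_continuous.
split; first split => //.
- move=> y Yy; split; last exact: (posterior_expectation c_ge0 qE P_moment).
  apply: (int_moment1 c_ge0 md q0 qm Yy).
  by have := @measurable_norm_val R H X x0 0; under eq_fun do rewrite subr0.
- by move=> y; rewrite YPE => /diffP[].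
- by move=> y /diffP[].
(* For empty [Y] the conjugate is a supremum over the empty set, identically -oo and so no penalty;
   the zero function serves instead. *)
- have [Y0|/set0P Y0] := eqVneq Y set0; last first.
    by exists (conjugate_penalty Y psi);
      [exact: (penalty_conjugate psiP)|exact: (implements_prox_conjugate psiP)].
  by exists (fun=> 0%E); [split => //; exists 0|move=> y; rewrite Y0].
move=> c0 nondeg.
have pd y : Y y -> pd_op ('d f_P y).
  by move=> Yy; exact: (mean_pd Yopen c_ge0 mh md q0 qt qm fE Yy (mn y) c0 nondeg).
have inj : {in Y &, injective f_P}.
  exact: (mean_injective c_ge0 mh md q0 qt qm fE c0 nondeg).
have [Y0|/set0P Y0] := eqVneq Y set0.
  exists (fun=> 0%E); first by split => //; exists 0.
  by split => //; move=> y; rewrite Y0.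
exists (conjugate_penalty Y psi); first exact: (penalty_conjugate psiP).
split => //.
- exact: (is_prox_conjugate Yopen psiP fcont).
- by move=> y u Yy; apply: (stationary_conjugate Yopen psiP) => //; exact: fcont.
- move=> Hfin y Yy.
  have [m [e [m0 e0 mono]]] :=
    differentiable_strongly_monotone Yopen Yy (diffP _ Yy).1 (pd _ Yy) Hfin.
  exact: (stationary_grad psiP Yy m0 e0 mono).
Qed.
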